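(* Let $G$ be a connected graph with $m$ edges. If the number of perfect matchings in the line graph $L(G)$ of $G$ is odd, then $G$ is $(1,2)$-choosable.
   Context: Graphs are finite and simple. The line graph $L(G)$ has the edges of $G$ as its vertices, two of them being adjacent when they share an endvertex in $G$. A perfect matching of a graph is a set of edges with pairwise no common endvertices that covers every vertex. A total-weighting of $G=(V,E)$ is a mapping $f:V\cup E\to\mathbb{R}$. For $v\in V$ put $s(v)=f(v)+\sum_{e\in E(v)}f(e)$, where $E(v)$ is the set of edges incident with $v$. The total-weighting $f$ is proper if $s(u)\neq s(v)$ for any two adjacent vertices $u,v$. The graph $G$ is $(k,k')$-choosable (total weight $(k,k')$-choosable) if for every assignment $L$ of a set $L(v)$ of $k$ real numbers to each vertex $v$ and a set $L(e)$ of $k'$ real numbers to each edge $e$, there is a proper total-weighting $f$ with $f(z)\in L(z)$ for all $z\in V\cup E$. *)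

(* Defs.v *)
From HB Require Import structures.
From mathcomp Require Import all_boot all_order all_algebra finmap.
From mathcomp Require Import reals.

Set Implicit Arguments.
Unset Strict Implicit.
Unset Printing Implicit Defensive.

Import GRing.Theory.
Local Open Scope ring_scope.

Record sgraph := SGraph {
  vertex :> finType;
  adj : rel vertex;
  adj_sym : symmetric adj;
  adj_irrefl : irreflexive adj }.

Definition edges (G : sgraph) : {set {set G}} :=
  [set A : {set G} | [exists x, exists y, adj x y && (A == [set x; y])]].

Record edge (G : sgraph) : Type := Edge {
  ends :> {set G};
  ends_edges : ends \in edges G }.
HB.instance Definition _ (G : sgraph) := [isSub for @ends G].
HB.instance Definition _ (G : sgraph) := [Finite of edge G by <:].

Definition endvertex (G : sgraph) (e : edge G) : pred G :=
  [pred v | v \in ends e].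

Definition connected_graph (G : sgraph) : Prop :=
  (0 < #|G|)%N /\ forall x y : G, connect (@adj G) x y.

Definition share_endvertex (G : sgraph) (e1 e2 : edge G) : bool :=
  [exists v, endvertex e1 v && endvertex e2 v].

Definition line_adj (G : sgraph) : rel (edge G) :=
  fun e1 e2 => (e1 != e2) && share_endvertex e1 e2.

Fact line_adj_sym (G : sgraph) : symmetric (@line_adj G).
Proof.
move=> e1 e2; rewrite /line_adj eq_sym; congr (_ && _).
by apply: eq_existsb => v; rewrite andbC.
Qed.

Fact line_adj_irrefl (G : sgraph) : irreflexive (@line_adj G).
Proof. by move=> e; rewrite /line_adj eqxx. Qed.

Definition line_graph (G : sgraph) : sgraph :=
  SGraph (@line_adj_sym G) (@line_adj_irrefl G).

Definition perfect_matching (G : sgraph) (M : {set edge G}) : bool :=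
  [forall e1 in M, forall e2 in M, (e1 != e2) ==> ~~ share_endvertex e1 e2]
  && [forall v, exists e in M, endvertex e v].

(* A total-weighting is a map on the disjoint sum [G + edge G] of the vertices
   and the edges. *)
Definition vsum (R : realType) (G : sgraph) (f : G + edge G -> R) (v : G) : R :=
  f (inl v) + \sum_(e : edge G | endvertex e v) f (inr e).

Definition proper_weighting (R : realType) (G : sgraph)
    (f : G + edge G -> R) : Prop :=
  forall u v : G, adj u v -> vsum f u <> vsum f v.

Definition choosable (R : realType) (G : sgraph) (k k' : nat) : Prop :=
  forall L : G + edge G -> {fset R},
    (forall v : G, #|` L (inl v)|%fset = k) ->
    (forall e : edge G, #|` L (inr e)|%fset = k') ->
    exists f : G + edge G -> R,
      proper_weighting f /\ forall z, f z \in L z.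

(* Main.v *)
Require Import Defs.
From mathcomp Require Import all_boot all_order all_algebra finmap.
From mathcomp Require Import reals.
From mathcomp Require Import fingroup perm.

(** The idea is the polynomial method with permanents.  Once a vertex
    weighting is fixed, orient every edge e of G as x -> y and ask that
    s(x) - s(y) be nonzero.  In this difference the weight of an edge e' enters
    with coefficient A(e, e') = [x in e'] - [y in e'].  Since every edge has
    two candidate weights, the product over e of these affine forms is a
    polynomial of degree m in m variables with two values each; by the
    Combinatorial Nullstellensatz it is nonzero at some point of the grid as
    soon as its coefficient at the product of all variables, which is the
    permanent of A, is nonzero ([permanent_choice]).  For this multilinear
    coefficient the Nullstellensatz reduces to a signed sum over the grid, an
    inclusion-exclusion in the style of Ryser's formula for the permanent
    ([alternating_sum_prod]).

    It remains to see that the permanent of A is odd.  Modulo 2, A is the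
    adjacency matrix of the line graph ([line_adj_parity]), so the permanent
    counts the permutations s of the edges that send every e to a neighbour of
    e in L(G).  As adjacency is symmetric, s and its inverse are counted
    together, and only the involutions matter ([odd_permanent]).  Such an
    involution pairs up the vertices of L(G) along edges of L(G): it is a
    perfect matching ([card_perfect_matchings]). *)

Set Implicit Arguments.
Unset Strict Implicit.
Unset Printing Implicit Defensive.

Import Order.TTheory GRing.Theory Num.Theory.
Local Open Scope ring_scope.

(** * Permanents and two-valued affine systems *)

Definition permanent (R : comNzRingType) (T : finType) (A : T -> T -> R) : R :=
  \sum_(s : {perm T}) \prod_i A i (s i).

(** The terms of the expanded product are indexed by functions to [option T],
    where [None] stands for the choice of the constant term of a factor; a
    permutation is the function that never makes this choice. *)
Definition perm_graph (T : finType) (s : {perm T}) : {ffun T -> option T} :=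
  [ffun i => Some (s i)].

Lemma perm_graph_inj (T : finType) : injective (@perm_graph T).
Proof.
move=> s t /ffunP st; apply/permP => i.
by have := st i; rewrite !ffunE => -[].
Qed.

(** Picking for each [j] a preimage of [Some j] gives an injection of the finite
    type [T] into itself, hence a bijection that leaves no room for [None]. *)
Lemma perm_graph_onto (T : finType) (g : {ffun T -> option T}) :
  (forall j, exists i, g i == Some j) -> exists s, perm_graph s = g.
Proof.
move=> /fin_all_exists[t gt].
have t_inj : injective t.
  by move=> j k tjk; have := gt k; rewrite -tjk (eqP (gt j)) => /eqP[].
exists (perm t_inj)^-1%g; apply/ffunP => i; rewrite ffunE.
set j := (perm t_inj)^-1%g i.
by have /eqP <- := gt j; rewrite -(permE t_inj) /j permKV.
Qed.

Lemma sum_onto_perm (R : nmodType) (T : finType)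
    (F : {ffun T -> option T} -> R) :
  \sum_(g : {ffun T -> option T} | [forall j, exists i, g i == Some j]) F g =
  \sum_(s : {perm T}) F (perm_graph s).
Proof.
pose h (g : {ffun T -> option T}) : {perm T} :=
  odflt 1%g [pick s | perm_graph s == g].
have hK s : h (perm_graph s) = s.
  rewrite /h; case: pickP => [t /eqP/perm_graph_inj //|/(_ s)].
  by rewrite eqxx.
rewrite (reindex_onto (@perm_graph T) h) => [|g /forallP g_onto].
  apply: eq_bigl => s; rewrite hK eqxx andbT; apply/forallP => j.
  by apply/existsP; exists (s^-1%g j); rewrite ffunE permKV.
have [|s <-] := @perm_graph_onto T g; last by rewrite hK.
by move=> j; apply/existsP.
Qed.

Lemma prod_indicator (R : comNzRingType) (T : finType) (P : pred T) :
  \prod_i (P i)%:R = [forall i, P i]%:R :> R.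
Proof.
case: forallP => [Pall|/forallP/forallPn[i /negPf Pi]].
  by rewrite big1 // => i _; rewrite Pall.
by rewrite (bigD1 i) //= Pi mul0r.
Qed.

(** Expand each product over functions [g] that select in factor [i] either
    the constant or one term [B i j].  The selection [g] occurs for the sets
    [S] that contain all columns it hits, and the signed number of these sets
    is zero unless every column is hit.  Then [g] is a permutation and only the
    full set [S] contributes, with sign [1]. *)
Lemma alternating_sum_prod (R : comNzRingType) (T : finType)
    (c : T -> R) (B : T -> T -> R) :
  \sum_(S : {set T}) (\prod_j (if j \in S then 1 else -1)) *
     \prod_i (c i + \sum_(j in S) B i j) = permanent B.
Proof.
pose a (S : {set T}) (o : option T) := if o is Some j then j \in S else true.
pose F i (o : option T) := if o is Some j then B i j else c i.
pose hit (g : {ffun T -> option T}) j := [exists i, g i == Some j].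
have expand (S : {set T}) : \prod_i (c i + \sum_(j in S) B i j) =
    \sum_(g : {ffun T -> option T}) \prod_i (F i (g i) * (a S (g i))%:R).
  rewrite -(bigA_distr_bigA (fun i o => F i o * (a S o)%:R)).
  apply: eq_bigr => i _; rewrite (bigD1 None) //= mulr1; congr (_ + _).
  rewrite (reindex_onto Some (odflt i)) => [|[j|]] //=.
  rewrite big_mkcond /= [in RHS]big_mkcond /=.
  by apply: eq_bigr => j _; rewrite eqxx mulr_natr mulrb.
have admissible (g : {ffun T -> option T}) S : \prod_i (a S (g i))%:R =
    \prod_j ((j \in S) || ~~ hit g j)%:R :> R.
  rewrite !prod_indicator; congr _%:R; congr nat_of_bool.
  apply/forallP/forallP => [gS j|gS i].
    rewrite orbC -implybE; apply/implyP => /existsP[i /eqP gi].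
    by have := gS i; rewrite gi.
  case gi: (g i) => [j|] //=; have := gS j; rewrite orbC -implybE => /implyP.
  by apply; apply/existsP; exists i; rewrite gi.
have inner (g : {ffun T -> option T}) :
    \sum_(S : {set T}) (\prod_j (if j \in S then 1 else -1)) *
       \prod_i (F i (g i) * (a S (g i))%:R) =
    if [forall j, hit g j] then \prod_i F i (g i) else 0.
  (* Column [j] in [S] contributes 1; outside [S] it contributes the sign -1,
     but only if [g] avoids it. *)
  transitivity (\prod_i F i (g i) * \prod_j (1 + - (~~ hit g j)%:R)).
    rewrite bigA_distr big_distrr /=; apply: eq_bigr => S _.
    rewrite big_split /= mulrCA; congr (_ * _).
    rewrite admissible -big_split /=; apply: eq_bigr => j _.
    by case: (j \in S) => /=; rewrite ?mul1r ?mulN1r.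
  under [X in _ * X]eq_bigr => j _.
    have -> : 1 + - (~~ hit g j)%:R = (hit g j)%:R :> R.
      by case: (hit g j); rewrite ?subr0 ?subrr.
    over.
  by rewrite prod_indicator mulr_natr mulrb.
under eq_bigr do rewrite expand big_distrr /=.
rewrite exchange_big /= /permanent.
under eq_bigr do rewrite inner.
rewrite -big_mkcond /= sum_onto_perm.
by apply: eq_bigr => s _; apply: eq_bigr => i _; rewrite ffunE.
Qed.

(** Multilinear case of the Combinatorial Nullstellensatz: if all grid points
    gave a zero product, then so would the alternating sum of
    [alternating_sum_prod], which equals the permanent of [A] times the product
    of the differences [b j - a j]. *)
Lemma permanent_choice (R : idomainType) (T : finType)
    (A : T -> T -> R) (c a b : T -> R) :
  (forall j, a j != b j) -> permanent A != 0 ->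
  exists x : T -> R, (forall j, x j = a j \/ x j = b j) /\
    forall i, c i + \sum_j A i j * x j != 0.
Proof.
move=> ab perA.
pose B i j := A i j * (b j - a j).
have perB : permanent B != 0.
  have -> : permanent B = permanent A * \prod_j (b j - a j).
    rewrite /permanent mulr_suml; apply: eq_bigr => s _.
    rewrite big_split /=; congr (_ * _).
    by rewrite [RHS](reindex_inj (@perm_inj _ s)).
  rewrite mulf_neq0 //; apply/prodf_neq0 => j _.
  by rewrite subr_eq0 eq_sym.
pose c' i := c i + \sum_j A i j * a j.
have [S ne0] : exists S : {set T}, \prod_i (c' i + \sum_(j in S) B i j) != 0.
  apply/existsP; rewrite -[X in is_true X]negbK negb_exists; apply: contra perB.
  move=> /forallP all0; rewrite -(alternating_sum_prod c') big1 // => S _.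
  by have /negPn/eqP-> := all0 S; rewrite mulr0.
exists (fun j => if j \in S then b j else a j); split=> [j|i].
  by case: ifP; [right | left].
have /prodf_neq0/(_ i isT) := ne0; apply: contra_neq; apply: etrans.
rewrite /c' -addrA; congr (_ + _); rewrite [X in _ + X]big_mkcond -big_split /=.
apply: eq_bigr => j _; rewrite /B; case: ifP => _; last by rewrite addr0.
by rewrite -mulrDr addrC subrK.
Qed.

(** * The parity of a permanent *)

(** The points that are not fixed split into orbits of length two. *)
Lemma odd_card_fixed (T : finType) (f : T -> T) (X : {set T}) :
  involutive f -> (forall x, (f x \in X) = (x \in X)) ->
  odd #|X| = odd #|[set x in X | f x == x]|.
Proof.
move=> fK Xf; pose Y := X :\: [set x | f x == x].
have Yf x : (f x \in Y) = (x \in Y) by rewrite !inE Xf fK eq_sym.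
have Y2 : Y \subset order_set f 2.
  apply/subsetP => x; rewrite !inE => /andP[fx _].
  rewrite (@order_cycle _ f [:: x; f x]) //=.
  - by rewrite fK !eqxx.
  - by rewrite inE eq_sym fx.
  - by rewrite inE eqxx.
have Ycl : fclosed f Y by move=> x y /eqP <-; rewrite Yf.
have := fcard_order_set (inv_inj fK) Y2 Ycl; rewrite muln2 => cY.
rewrite -(cardsID [set x | f x == x] X) oddD -/Y -cY odd_double addbF.
by congr (odd _); apply: eq_card => x; rewrite !inE.
Qed.

(** The permutations supported on a symmetric relation are closed under
    inversion, so modulo 2 only the involutions among them count. *)
Lemma odd_permanent (T : finType) (r : rel T) (A : T -> T -> int) :
  symmetric r -> (forall i j, (A i j)%:~R = (r i j)%:R :> 'F_2) ->
  odd #|[set s : {perm T} | (s^-1%g == s) && [forall i, r i (s i)]]| ->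
  permanent A != 0.
Proof.
move=> r_sym Ar odd_inv; pose X := [set s : {perm T} | [forall i, r i (s i)]].
have oddX : odd #|X|.
  rewrite (odd_card_fixed (f := @invg _)) => [||s].
  - apply: etrans odd_inv; congr (odd #|pred_of_set _|).
    by apply/setP => s; rewrite !inE andbC.
  - exact: invgK.
  rewrite !inE; apply/forallP/forallP => rs i.
    by have := rs (s i); rewrite permK r_sym.
  by have := rs (s^-1%g i); rewrite permKV r_sym.
apply: contraL oddX => /eqP perA0.
have : (permanent A)%:~R = (#|X|)%:R :> 'F_2.
  rewrite rmorph_sum -sum1_card natr_sum [in RHS]big_mkcond /=.
  apply: eq_bigr => s _; rewrite inE rmorph_prod /=.
  case: forallP => [rs|/forallP/forallPn[i /negPf rs]].
    by rewrite big1 // => i _; rewrite Ar rs.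
  by rewrite (bigD1 i) //= Ar rs mul0r.
rewrite perA0 => /esym/eqP; rewrite -(dvdn_pcharf (pchar_Fp _)) //.
by rewrite dvdn2.
Qed.

(** * Perfect matchings as involutions *)

Lemma edge_ends (G : sgraph) (e : edge G) :
  exists p : G * G, adj p.1 p.2 /\ ends e = [set p.1; p.2].
Proof.
have := ends_edges e; rewrite inE => /existsP[x /existsP[y /andP[xy /eqP eE]]].
by exists (x, y).
Qed.

Lemma adj_edge (G : sgraph) (x y : G) :
  adj x y -> exists e : edge G, ends e = [set x; y].
Proof.
move=> xy; have xyE : [set x; y] \in edges G.
  by rewrite inE; apply/existsP; exists x; apply/existsP; exists y; rewrite xy /=.
by exists (Edge xyE).
Qed.

Lemma ends_inj (G : sgraph) : injective (@ends G).
Proof. exact: val_inj. Qed.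

Lemma card_ends (G : sgraph) (e : edge G) : #|ends e| = 2.
Proof.
have [[x y] /= [xy ->]] := edge_ends e; rewrite cards2.
by case: eqVneq xy => // ->; rewrite adj_irrefl.
Qed.

Lemma ends_other (G : sgraph) (e : edge G) v :
  endvertex e v -> exists w, adj v w /\ ends e = [set v; w].
Proof.
have [[x y] /= [xy eE]] := edge_ends e.
rewrite /endvertex /= eE => /set2P[] ->; first by exists y.
by exists x; rewrite adj_sym setUC.
Qed.

Definition pairing (G : sgraph) (s : {perm G}) : bool :=
  (s^-1%g == s) && [forall v, adj v (s v)].

Definition matching_of (G : sgraph) (s : {perm G}) : {set edge G} :=
  [set e | [exists v, ends e == [set v; s v]]].

Lemma pairingP (G : sgraph) (s : {perm G}) :
  reflect (involutive s /\ forall v, adj v (s v)) (pairing s).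
Proof.
apply: (iffP andP) => [[/eqP sV /forallP s_adj]|[sK s_adj]]; split=> //.
- by move=> v; rewrite -{1}sV permK.
- by apply/eqP/permP => v; apply: (@perm_inj _ s); rewrite permKV sK.
- exact/forallP.
Qed.

Lemma matching_of_edge (G : sgraph) (s : {perm G}) (e : edge G) v :
  pairing s -> e \in matching_of s -> endvertex e v -> ends e = [set v; s v].
Proof.
case/pairingP => sK _; rewrite inE => /existsP[u /eqP eE].
by rewrite /endvertex /= eE => /set2P[->|->] //; rewrite sK setUC.
Qed.

Lemma matching_of_perfect (G : sgraph) (s : {perm G}) :
  pairing s -> perfect_matching (matching_of s).
Proof.
move=> s_pair; apply/andP; split.
  apply/forall_inP => e1 e1M; apply/forall_inP => e2 e2M.
  apply/implyP; apply: contra => /existsP[v /andP[v1 v2]].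
  apply/eqP/ends_inj.
  by rewrite (matching_of_edge s_pair e1M v1) (matching_of_edge s_pair e2M v2).
apply/forallP => v; have [_ s_adj] := pairingP _ s_pair.
have [e eE] := adj_edge (s_adj v); apply/existsP; exists e.
rewrite inE /endvertex /= eE set21 andbT.
by apply/existsP; exists v.
Qed.

Lemma matching_of_inj (G : sgraph) :
  {in [set s : {perm G} | pairing s] &, injective (@matching_of G)}.
Proof.
move=> s t; rewrite !inE => s_pair t_pair st; apply/permP => v.
have [_ s_adj] := pairingP _ s_pair; have [e eE] := adj_edge (s_adj v).
have eM : e \in matching_of s by rewrite inE; apply/existsP; exists v; rewrite eE.
have v_e : endvertex e v by rewrite /endvertex /= eE set21.
have : s v \in [set v; t v].
  by rewrite st in eM; rewrite -(matching_of_edge t_pair eM v_e) eE set22.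
case/set2P => // sv; have := s_adj v.
by rewrite sv adj_irrefl.
Qed.

(** The partner of a vertex is the other end of the edge of [M] that covers it;
    this edge is unique, so being partners is a symmetric relation. *)
Lemma matching_of_onto (G : sgraph) (M : {set edge G}) :
  perfect_matching M -> exists2 s : {perm G}, pairing s & matching_of s = M.
Proof.
case/andP => /forall_inP M_disj /forallP M_cov.
have uniq e1 e2 v : e1 \in M -> e2 \in M -> endvertex e1 v -> endvertex e2 v ->
    e1 = e2.
  move=> M1 M2 v1 v2; apply/eqP; have /forall_inP/(_ _ M2) := M_disj _ M1.
  by apply: contraLR => ne; rewrite ne /= negbK; apply/existsP; exists v; apply/andP.
have /fin_all_exists[g gP] (v : G) :
    exists w, adj v w /\ exists2 e, e \in M & ends e = [set v; w].
  have /existsP[e /andP[eM v_e]] := M_cov v.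
  by have [w [vw eE]] := ends_other v_e; exists w; split=> //; exists e.
have gE e v : e \in M -> endvertex e v -> ends e = [set v; g v].
  move=> eM v_e; have [_ [e' e'M e'E]] := gP v.
  by rewrite (uniq _ _ v eM e'M) //= /endvertex /= e'E set21.
have gK : involutive g.
  move=> v; have [vgv [e eM eE]] := gP v.
  have gv_e : endvertex e (g v) by rewrite /endvertex /= eE set22.
  have : v \in [set g v; g (g v)] by rewrite -(gE _ _ eM gv_e) eE set21.
  by case/set2P => // vE; rewrite -vE adj_irrefl in vgv.
exists (perm (inv_inj gK)).
  apply/pairingP; split=> v; rewrite !permE //.
  by have [] := gP v.
apply/setP => e; rewrite inE; apply/existsP/idP => [[v]|eM].
  rewrite permE => /eqP eE; have [_ [e' e'M e'E]] := gP v.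
  by rewrite (@ends_inj _ e e') // eE.
have [[x y] /= [_ eE]] := edge_ends e; exists x; rewrite permE; apply/eqP.
by apply: gE; rewrite // /endvertex /= eE set21.
Qed.

Lemma card_perfect_matchings (G : sgraph) :
  #|[set M : {set edge G} | perfect_matching M]| =
  #|[set s : {perm G} | pairing s]|.
Proof.
rewrite -(card_in_imset (@matching_of_inj G)); congr #|pred_of_set _|.
apply/setP => M; rewrite inE; apply/idP/imsetP => [/matching_of_onto[s]|[s]].
  by move=> s_pair <-; exists s; rewrite ?inE.
by rewrite inE => s_pair ->; apply: matching_of_perfect.
Qed.

(** * The coefficient matrix modulo 2 *)

(** In a simple graph, two edges that have both endvertices in common are
    equal.  Hence an edge containing both ends of [e] is [e] itself, which is
    not adjacent to [e], while an edge containing exactly one of them is. *)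
Lemma line_adj_parity (G : sgraph) (e e' : edge G) (x y : G) :
  ends e = [set x; y] -> line_adj e e' = (endvertex e' x) (+) (endvertex e' y).
Proof.
move=> eE; rewrite /line_adj /share_endvertex.
have -> : [exists v, endvertex e v && endvertex e' v] =
    endvertex e' x || endvertex e' y.
  apply/existsP/orP => [[v /andP[]]|[] v_e'].
  - by rewrite /endvertex /= eE => /set2P[]->; [left | right].
  - by exists x; rewrite v_e' /endvertex /= eE set21.
  - by exists y; rewrite v_e' /endvertex /= eE set22.
case: (eqVneq e e') => [<-|ne] /=; first by rewrite /endvertex /= eE set21 set22.
case x_e': (endvertex e' x); case y_e': (endvertex e' y) => //=.
case/eqP: ne; apply/ends_inj/eqP.
rewrite eqEcard !card_ends leqnn andbT eE; apply/subsetP => v.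
by case/set2P => ->.
Qed.

Theorem theorem2p2 (R : realType) (G : sgraph) (m : nat)
  (hG : connected_graph G)
  (hm : #|edges G| = m)
  (hodd : odd #|[set M : {set edge (line_graph G)} | perfect_matching M]|) :
  choosable R G 1 2.
Proof.
move=> L Lv Le.
have /fin_all_exists[c cP] (v : G) : exists c : R, c \in L (inl v).
  by have /eqP/cardfs1P[c ->] := Lv v; exists c; rewrite fset11.
have /fin_all_exists[ab abP] (e : edge G) :
    exists p : R * R, [/\ p.1 != p.2, p.1 \in L (inr e) & p.2 \in L (inr e)].
  have card2 := Le e; have /fset0Pn[a aL] : L (inr e) != fset0.
    by rewrite -cardfs_gt0 card2.
  have /fset0Pn[b] : (L (inr e) `\ a)%fset != fset0.
    by rewrite -cardfs_gt0; move: card2; rewrite (cardfsD1 a) aL add1n => -[->].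
  by rewrite in_fsetD1 eq_sym => /andP[ab bL]; exists (a, b).
have /fin_all_exists[o oP] := @edge_ends G.
pose A (e e' : edge G) : int := (endvertex e' (o e).1)%:R - (endvertex e' (o e).2)%:R.
(* Signs vanish modulo 2, which makes [A] the adjacency matrix of [L(G)]. *)
have perA : permanent A != 0.
  apply: (odd_permanent (@line_adj_sym G)) => [e e'|].
    have [_ oE] := oP e; rewrite (line_adj_parity e' oE) rmorphB /=.
    by case: (endvertex e' _); case: (endvertex e' _); apply/eqP.
  by rewrite card_perfect_matchings in hodd.
have perAR : permanent (fun e e' => (A e e')%:~R : R) != 0.
  have -> : permanent (fun e e' => (A e e')%:~R : R) = (permanent A)%:~R.
    rewrite rmorph_sum; apply: eq_bigr => s _.
    by rewrite rmorph_prod.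
  by rewrite intr_eq0.
have ab_ne e : (ab e).1 != (ab e).2 by case: (abP e).
(* The constant terms come from the vertex weights, which are forced. *)
have [x [xab xne]] :=
  permanent_choice (fun e => c (o e).1 - c (o e).2) ab_ne perAR.
exists (fun z => match z with inl v => c v | inr e => x e end); split; last first.
  case=> [v|e]; first exact: cP.
  by have [_ aL bL] := abP e; have [->|->] := xab e.
set f := (fun z => _).
have ne e : vsum f (o e).1 - vsum f (o e).2 != 0.
  have := xne e; apply: contra_neq; apply: etrans; rewrite /vsum /= opprD addrACA; congr (_ + _).
  rewrite [X in _ = X - _]big_mkcond [X in _ = _ - X]big_mkcond -sumrB /=.
  apply: eq_bigr => e' _; rewrite rmorphB /= mulrBl.
  by do 2!case: (endvertex e' _); rewrite ?mul1r ?mul0r.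
(* The chosen orientation of the edge may be [u -> v] or [v -> u]. *)
move=> u v /adj_edge[e eE] uv; have [o_adj oE] := oP e; have /eqP := ne e; apply.
have := set21 (o e).1 (o e).2; have := set22 (o e).1 (o e).2.
rewrite -oE eE => /set2P[]-> /set2P[]->; rewrite ?uv subrr //.
Qed.
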